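(* Every theorem of the axiom system $\mathbf{RCD}$ is valid in the class of all pseudo models, i.e., if $\phi$ is provable in $\mathbf{RCD}$ then $\mathfrak{M},s\models_{\mathsf p}\phi$ for every pseudo model $\mathfrak{M}$ and every state $s$ of $\mathfrak{M}$.
   Context: Fix a finite set $\textsc{ag}$ of agents and a countable set $\textsc{prop}$ of propositional variables; groups are nonempty subsets of $\textsc{ag}$. $\mathcal{RCD}$: $\phi ::= p \mid \neg\phi \mid \phi\wedge\phi \mid K_i\phi \mid D_G\phi \mid C_G\phi \mid R_G\phi$; $E_G\phi$ abbreviates $\bigwedge_{i\in G}K_i\phi$. A pre-model is $\mathfrak{M}=(S,\backsim,V)$ with $S$ nonempty, an equivalence relation $\backsim_i$ for each agent and $\backsim_G$ for each group (primitive), and $V:\textsc{prop}\to\wp(S)$; $\backsim_{C_G}$ is the reflexive transitive closure of $\bigcup_{i\in G}\backsim_i$. A pseudo model is a pre-model with $\backsim_{\{i\}}=\backsim_i$ for all $i$ and $\backsim_H\subseteq\backsim_G$ whenever $G\subseteq H$. Update: $\mathfrak{M}|_G$ has $(\backsim|_G)_i=\backsim_G$ if $i\in G$, else $\backsim_i$; $(\backsim|_G)_H=\backsim_{H\cup G}$ if $H\cap G\neq\emptyset$, else $\backsim_H$. Pseudo satisfaction $\models_{\mathsf p}$: atoms via $V$; Booleans as usual; $K_i$, $D_G$, $C_G$ are boxes over $\backsim_i$, $\backsim_G$, $\backsim_{C_G}$ respectively; $\mathfrak{M},s\models_{\mathsf p}R_G\phi$ iff $\mathfrak{M}|_G,s\models_{\mathsf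 p}\phi$. $\mathbf{RCD}$ consists of: propositional tautologies; for each $K_i$ the axioms $K_i(\phi\to\psi)\to(K_i\phi\to K_i\psi)$, $K_i\phi\to\phi$, $K_i\phi\to K_iK_i\phi$, $\neg K_i\phi\to K_i\neg K_i\phi$; modus ponens; from $\phi$ infer $K_i\phi$; $D_G(\phi\to\psi)\to(D_G\phi\to D_G\psi)$; $D_G\phi\to\phi$; $\neg D_G\phi\to D_G\neg D_G\phi$; $K_i\phi\leftrightarrow D_{\{i\}}\phi$; $D_G\phi\to D_H\phi$ if $G\subseteq H$; $C_G(\phi\to\psi)\to(C_G\phi\to C_G\psi)$; $C_G\phi\to\phi$; $C_G\phi\to E_GC_G\phi$; $C_G(\phi\to E_G\phi)\to(\phi\to C_G\phi)$; from $\phi$ infer $C_G\phi$; $R_Gp\leftrightarrow p$; $R_G(\phi\wedge\psi)\leftrightarrow R_G\phi\wedge R_G\psi$; $R_G\neg\phi\leftrightarrow\neg R_G\phi$; $R_GD_H\phi\leftrightarrow D_{G\cup H}R_G\phi$ if $G\cap H\neq\emptyset$; $R_GD_H\phi\leftrightarrow D_HR_G\phi$ if $G\cap H=\emptyset$; from $\phi$ infer $R_G\phi$; and for groups $G_1,\dots,G_n,H$: from $\phi\to(E_H\phi\wedge R_{G_1}\cdots R_{G_n}\psi)$ infer $\phi\to R_{G_1}\cdots R_{G_n}C_H\psi$. *)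

(* Defs.v *)
From HB Require Import structures.
From Stdlib Require Import Relations.
From mathcomp Require Import all_boot.

Set Implicit Arguments.
Unset Strict Implicit.
Unset Printing Implicit Defensive.

Record group (ag : finType) := Group {
  gset :> {set ag};
  group_neq0 : gset != set0
}.

HB.instance Definition _ (ag : finType) := [isSub for @gset ag].

Section Groups.
Variable ag : finType.

Lemma set1_neq0 (i : ag) : [set i] != set0.
Proof. by apply/set0Pn; exists i; rewrite set11. Qed.

Lemma setU_neq0 (G H : group ag) : G :|: H != set0.
Proof. by rewrite setU_eq0 negb_and group_neq0. Qed.

Definition gsing (i : ag) : group ag := Group (set1_neq0 i).
Definition gunion (G H : group ag) : group ag := Group (setU_neq0 G H).

End Groups.

Inductive form (ag : finType) (prop : countType) : Type :=
| Atom of prop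
| Neg of form ag prop
| And of form ag prop & form ag prop
| K of ag & form ag prop
| D of group ag & form ag prop
| C of group ag & form ag prop
| R of group ag & form ag prop.

Arguments Atom {ag prop} p.

Section Abbreviations.
Variables (ag : finType) (prop : countType).
Implicit Types (phi psi : form ag prop) (G : group ag).

Definition Imp phi psi : form ag prop := Neg (And phi (Neg psi)).
Definition Iff phi psi : form ag prop := And (Imp phi psi) (Imp psi phi).

(* Conjunction of the sequence x :: s, which is nonempty, so that no constant
   for truth is needed. *)
Fixpoint bigAnd (x : form ag prop) (s : seq (form ag prop)) : form ag prop :=
  if s is y :: s' then And x (bigAnd y s') else x.

(* The first branch is unreachable, since groups are nonempty. *)
Definition E G phi : form ag prop :=
  match enum G with
  | [::] => phi
  | i :: s => bigAnd (K i phi) [seq K j phi | j <- s]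
  end.

(* R_{G_1} ... R_{G_n} phi for Gs = [:: G_1; ...; G_n]. *)
Definition Rs (Gs : seq (group ag)) phi : form ag prop :=
  foldr (@R ag prop) phi Gs.

(* Truth-functional evaluation: subformulas whose main connective is not
   Boolean are treated as atoms, so that tautologies are exactly the
   substitution instances of propositional tautologies. *)
Fixpoint teval (v : form ag prop -> bool) phi : bool :=
  match phi with
  | Neg psi => ~~ teval v psi
  | And psi chi => teval v psi && teval v chi
  | _ => v phi
  end.

Definition tautology phi : Prop := forall v, teval v phi.

End Abbreviations.

Record premodel (ag : finType) (prop : countType) := PreModel {
  state : Type;
  state_inhabited : inhabited state;
  rel_ag : ag -> relation state;
  rel_gr : group ag -> relation state;
  rel_ag_equiv : forall i, equivalence state (rel_ag i);
  rel_gr_equiv : forall G, equivalence state (rel_gr G);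
  val_at : prop -> state -> Prop
}.

Section Models.
Variables (ag : finType) (prop : countType).
Implicit Types (M : premodel ag prop) (G H : group ag).

Definition rel_ck M G : relation (state M) :=
  clos_refl_trans (state M) (fun s t => exists2 i, i \in G & rel_ag i s t).

Definition pseudo_model M : Prop :=
  (forall i s t, @rel_gr _ _ M (gsing i) s t <-> @rel_ag _ _ M i s t) /\
  (forall G H, G \subset H ->
     forall s t, @rel_gr _ _ M H s t -> @rel_gr _ _ M G s t).

Definition upd_ag M G (i : ag) : relation (state M) :=
  if i \in G then rel_gr G else rel_ag i.

Definition upd_gr M G H : relation (state M) :=
  if H :&: G != set0 then rel_gr (gunion H G) else rel_gr H.

Lemma upd_ag_equiv M G i : equivalence (state M) (@upd_ag M G i).
Proof.
by rewrite /upd_ag; case: ifP => _; [exact: rel_gr_equiv | exact: rel_ag_equiv].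
Qed.

Lemma upd_gr_equiv M G H : equivalence (state M) (@upd_gr M G H).
Proof. by rewrite /upd_gr; case: ifP => _; exact: rel_gr_equiv. Qed.

Definition update M G : premodel ag prop :=
  PreModel (state_inhabited M) (@upd_ag_equiv M G) (@upd_gr_equiv M G)
           (@val_at _ _ M).

Fixpoint psat M (s : state M) (phi : form ag prop) {struct phi} : Prop :=
  match phi with
  | Atom p => val_at p s
  | Neg psi => ~ psat s psi
  | And psi chi => psat s psi /\ psat s chi
  | K i psi => forall t, rel_ag i s t -> psat t psi
  | D G psi => forall t, rel_gr G s t -> psat t psi
  | C G psi => forall t, rel_ck G s t -> psat t psi
  | R G psi => @psat (update M G) s psi
  end.

End Models.

Section ProofSystem.
Variables (ag : finType) (prop : countType).
Implicit Types (phi psi : form ag prop) (i : ag) (G H : group ag).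

Inductive RCD : form ag prop -> Prop :=
| RCD_taut phi : tautology phi -> RCD phi
| RCD_MP phi psi : RCD (Imp phi psi) -> RCD phi -> RCD psi
| RCD_K_K i phi psi : RCD (Imp (K i (Imp phi psi)) (Imp (K i phi) (K i psi)))
| RCD_K_T i phi : RCD (Imp (K i phi) phi)
| RCD_K_4 i phi : RCD (Imp (K i phi) (K i (K i phi)))
| RCD_K_5 i phi : RCD (Imp (Neg (K i phi)) (K i (Neg (K i phi))))
| RCD_K_nec i phi : RCD phi -> RCD (K i phi)
| RCD_D_K G phi psi : RCD (Imp (D G (Imp phi psi)) (Imp (D G phi) (D G psi)))
| RCD_D_T G phi : RCD (Imp (D G phi) phi)
| RCD_D_5 G phi : RCD (Imp (Neg (D G phi)) (D G (Neg (D G phi))))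
| RCD_D_sing i phi : RCD (Iff (K i phi) (D (gsing i) phi))
| RCD_D_mono G H phi : G \subset H -> RCD (Imp (D G phi) (D H phi))
| RCD_C_K G phi psi : RCD (Imp (C G (Imp phi psi)) (Imp (C G phi) (C G psi)))
| RCD_C_T G phi : RCD (Imp (C G phi) phi)
| RCD_C_mix G phi : RCD (Imp (C G phi) (E G (C G phi)))
| RCD_C_ind G phi : RCD (Imp (C G (Imp phi (E G phi))) (Imp phi (C G phi)))
| RCD_C_nec G phi : RCD phi -> RCD (C G phi)
| RCD_R_atom G (p : prop) : RCD (Iff (R G (Atom p)) (Atom p))
| RCD_R_and G phi psi :
    RCD (Iff (R G (And phi psi)) (And (R G phi) (R G psi)))
| RCD_R_neg G phi : RCD (Iff (R G (Neg phi)) (Neg (R G phi)))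
| RCD_R_D_meet G H phi : G :&: H != set0 ->
    RCD (Iff (R G (D H phi)) (D (gunion G H) (R G phi)))
| RCD_R_D_disj G H phi : G :&: H = set0 ->
    RCD (Iff (R G (D H phi)) (D H (R G phi)))
| RCD_R_nec G phi : RCD phi -> RCD (R G phi)
| RCD_R_C (Gs : seq (group ag)) H phi psi :
    RCD (Imp phi (And (E H phi) (Rs Gs psi))) ->
    RCD (Imp phi (Rs Gs (C H psi))).

End ProofSystem.

(* Main.v *)
Require Import Defs.
From HB Require Import structures.
From Stdlib Require Import Relations.
From Stdlib Require Import ClassicalEpsilon.
From mathcomp Require Import all_boot.

(** Soundness by induction on derivations, for all pseudo models at once. Two
    facts carry the argument: the class of pseudo models is closed under
    updates, which gives necessitation for [R]; and an update can only shrink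
    the relation of each agent. Hence, in the rule introducing
    [R_{G_1} ... R_{G_n} C_H psi], a formula [phi] preserved along the agents of
    [H] in [M] is still preserved along their relations in the updated model. *)

Section Soundness.
Local Set Implicit Arguments.
Local Unset Strict Implicit.
Variables (ag : finType) (prop : countType).
Implicit Types (M : premodel ag prop) (G H : group ag) (phi psi : form ag prop).

(** The nonemptiness proofs are irrelevant, so equality of the underlying sets suffices. This
    reconciles the order of [G] and [H] in the update with that in the reduction axioms. *)
Lemma gunionC G H : gunion G H = gunion H G.
Proof. by apply: val_inj; rewrite /= setUC. Qed.

Lemma upd_gr_meet {M G H} : G :&: H != set0 ->
  upd_gr (M := M) G H = rel_gr (gunion G H).
Proof. by rewrite /upd_gr setIC gunionC => ->. Qed.

Lemma upd_gr_disj {M G H} : G :&: H = set0 ->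
  upd_gr (M := M) G H = rel_gr H.
Proof. by rewrite /upd_gr setIC => ->; rewrite eqxx. Qed.

Lemma update_pseudo M G : pseudo_model M -> pseudo_model (update M G).
Proof.
move=> [sing mono]; split=> [i s t | H1 H2 sub s t] /=.
(* [gsing i] meets [G] exactly when [i] is in [G], so both relations are updated or neither is. *)
- rewrite /upd_ag; case: ifP => iG.
  + have GI : G :&: gsing i != set0.
      by apply/set0Pn; exists i; rewrite inE iG set11.
    rewrite upd_gr_meet //; suff -> : gunion G (gsing i) = G by [].
    by apply/val_inj/setUidPl; rewrite sub1set.
  + have GI : G :&: gsing i = set0.
      by apply: disjoint_setI0; rewrite disjoint_sym disjoints1 iG.
    by rewrite upd_gr_disj //; exact: sing.
(* If [G] meets [H1], it meets the larger [H2]; this leaves three cases, each an instance of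
   [mono]. *)
- case: (eqVneq (G :&: H1) set0) => [G1 | G1].
  + rewrite [upd_gr G H1](upd_gr_disj G1).
    case: (eqVneq (G :&: H2) set0) => [/upd_gr_disj | /upd_gr_meet] -> /=.
      exact: mono.
    by apply: mono; rewrite (subset_trans sub) ?subsetUr.
  + have G2 : G :&: H2 != set0.
      by apply: contraNneq G1 => G2; rewrite -subset0 -G2 setIS.
    rewrite [upd_gr G H1](upd_gr_meet G1) [upd_gr G H2](upd_gr_meet G2).
    by apply: mono; rewrite /= setUS.
Qed.

Lemma upd_ag_sub M G i s t : pseudo_model M ->
  upd_ag (M := M) G i s t -> rel_ag i s t.
Proof.
move=> [sing mono]; rewrite /upd_ag; case: ifP => // iG st.
by apply/sing; apply: mono st; rewrite sub1set.
Qed.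

Lemma psat_Imp M (s : state M) phi psi :
  psat s (Imp phi psi) <-> (psat s phi -> psat s psi).
Proof.
split=> [/= sI sphi | sI /= [sphi]]; last by apply; exact: sI.
by apply: NNPP => Nspsi; exact: sI.
Qed.

Lemma psat_Iff M (s : state M) phi psi :
  (psat s phi <-> psat s psi) -> psat s (Iff phi psi).
Proof. by move=> [pq qp]; split; apply/psat_Imp. Qed.

Lemma psat_bigAnd M (s : state M) phi i (r : seq ag) :
  psat s (bigAnd (K i phi) [seq K j phi | j <- r]) <->
  (forall j, j \in i :: r -> psat s (K j phi)).
Proof.
elim: r i => [|k r IH] i.
  by split=> [si j /[!inE]/eqP-> // | ]; apply; rewrite mem_head.
split=> [[si /IH sr] j | sr].
  by rewrite inE => /orP[/eqP-> // | /sr].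
split; first by apply: sr; rewrite mem_head.
by apply/IH => j jr; apply: sr; rewrite inE jr orbT.
Qed.

Lemma psat_E M (s : state M) G phi :
  psat s (E G phi) <->
  (forall i, i \in G -> forall t, rel_ag i s t -> psat t phi).
Proof.
have memG i : (i \in G) = (i \in enum G) by rewrite mem_enum.
rewrite /E; case: (enum G) memG => [|j r] memG.
  by case/set0Pn: (group_neq0 G) => i; rewrite memG.
split=> [/psat_bigAnd sE i | sE]; first by rewrite memG; exact: sE.
by apply/psat_bigAnd => i iG; apply: sE; rewrite memG.
Qed.

(** Excluded middle turns truth at [s] into a Boolean valuation [v], and [teval v] agrees with
    [psat s] on all formulas. *)
Lemma psat_tautology M (s : state M) phi : tautology phi -> psat s phi.
Proof.
pose v psi : bool :=
  if excluded_middle_informative (psat s psi) then true else false.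
have vP psi : psat s psi <-> v psi.
  by rewrite /v; case: excluded_middle_informative.
suff tevalP psi : psat s psi <-> teval v psi by move=> /(_ v) /tevalP.
elim: psi => [p|psi IH|psi IH1 chi IH2|i psi _|G psi _|G psi _|G psi _];
  try exact: vP; rewrite /=.
- by rewrite IH; split=> /negP.
- by rewrite IH1 IH2; split=> /andP.
Qed.

(* [P] stays a predicate on the states of the original model throughout: an
   update does not change the carrier, up to conversion. *)
Lemma psat_Rs_C Gs H psi M (P : state M -> Prop) : pseudo_model M ->
  (forall s t i, i \in H -> rel_ag i s t -> P s -> P t) ->
  (forall s, P s -> psat s (Rs Gs psi)) ->
  forall s, P s -> psat s (Rs Gs (C H psi)).
Proof.
elim: Gs M P => [|G Gs IH] M P pM Pstep Ppsi s Ps /=.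
  (* With no update left, [P] is carried along the path from [s] to [t]. *)
  move=> t st; apply: Ppsi.
  elim: st Ps => {s t} [s t [i iH st] | // | s t u _ st _ tu].
    exact: Pstep st.
  by move=> /st.
apply: (IH (update M G) P) => //; first exact: update_pseudo.
by move=> x y i iH /(upd_ag_sub pM); exact: Pstep.
Qed.

Lemma equivalence_euclidean (T : Type) (r : relation T) s t u :
  equivalence T r -> r s t -> r s u -> r t u.
Proof. by move=> [_ tr sy] st su; apply: tr su; exact: sy. Qed.

Lemma RCD_sound phi : RCD phi -> forall M, pseudo_model M ->
  forall s : state M, psat s phi.
Proof.
elim=> {phi}
  [phi taut|phi psi _ IHi _ IH|i phi psi|i phi|i phi|i phi|i phi _ IH
  |G phi psi|G phi|G phi|i phi|G H phi GH|G phi psi|G phi|G phi|G phi|G phi _ IH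
  |G p|G phi psi|G phi|G H phi GH|G H phi GH|G phi _ IH|Gs H phi psi _ IH] M pM s.
- exact: psat_tautology.
- by move/psat_Imp: (IHi M pM s); apply; exact: IH.
- apply/psat_Imp => sI; apply/psat_Imp => sphi t st.
  by move/psat_Imp: (sI t st); apply; exact: sphi.
- by apply/psat_Imp; apply; case: (rel_ag_equiv M i) => + _ _; apply.
- apply/psat_Imp => sphi t st u tu; apply: sphi.
  by case: (rel_ag_equiv M i) => _ tr _; exact: tr tu.
- apply/psat_Imp => Ns t st /= tphi; apply: Ns => u su; apply: tphi.
  exact: equivalence_euclidean (rel_ag_equiv M i) st su.
- by move=> t _; exact: IH.
- apply/psat_Imp => sI; apply/psat_Imp => sphi t st.
  by move/psat_Imp: (sI t st); apply; exact: sphi.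
- by apply/psat_Imp; apply; case: (rel_gr_equiv M G) => + _ _; apply.
- apply/psat_Imp => Ns t st /= tphi; apply: Ns => u su; apply: tphi.
  exact: equivalence_euclidean (rel_gr_equiv M G) st su.
- by case: pM => sing _; apply: psat_Iff; split=> sphi t /sing; exact: sphi.
- case: pM => _ mono; apply/psat_Imp => sphi t st; apply: sphi.
  exact: mono st.
- apply/psat_Imp => sI; apply/psat_Imp => sphi t st.
  by move/psat_Imp: (sI t st); apply; exact: sphi.
- by apply/psat_Imp; apply; exact: rt_refl.
- apply/psat_Imp => sphi; apply/psat_E => i iG t st u tu; apply: sphi.
  by apply: rt_trans tu; apply: rt_step; exists i.
(* Paths are extended at their far end: the boxed implication then applies at the penultimate state,
   which is reachable from [s]. *)
- apply/psat_Imp => sI; apply/psat_Imp => sphi t /clos_rt_rtn1_iff.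
  elim=> // {}t u [i iG tu] /clos_rt_rtn1_iff st tphi.
  by move/psat_Imp: (sI t st) => /(_ tphi) /psat_E /(_ i iG u tu).
- by move=> t _; exact: IH.
(* For atoms, conjunction and negation, both sides are convertible, as an update keeps states and
   valuation. *)
- exact: psat_Iff.
- exact: psat_Iff.
- exact: psat_Iff.
- by apply: psat_Iff; rewrite /= (upd_gr_meet GH).
- by apply: psat_Iff; rewrite /= (upd_gr_disj GH).
- by apply: IH; exact: update_pseudo.
(* The premise is needed at every state, so that the truth set of [phi] in [M] can serve as [P]. *)
- have valid (t : state M) : psat t phi -> psat t (E H phi) /\ psat t (Rs Gs psi).
    by move/psat_Imp: (IH M pM t).
  apply/psat_Imp; apply: (@psat_Rs_C _ _ _ _ (fun t => psat t phi)) => // [t u i iH tu | t] /valid [].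
    by move=> /psat_E /(_ i iH u tu).
  by [].
Qed.

End Soundness.

Theorem theorem2 (ag : finType) (prop : countType) (phi : form ag prop) :
  RCD phi ->
  forall (M : premodel ag prop), pseudo_model M ->
  forall s : state M, psat s phi.
Proof. exact: RCD_sound. Qed.
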